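(* Let $a,g$ be nonnegative integers. There exists a unique nonnegative integer $b$ such that the position $(a,b)$ of $\mathcal{F}$-Wythoff has Sprague-Grundy value $\mathcal{G}(a,b)=g$.
   Context: $\lfloor\cdot\rfloor$ is the integer part. A position is an unordered pair $(a,b)$ of nonnegative integers (two piles of tokens); $(a,b)$ is identified with $(b,a)$, so $\mathcal{G}(a,b)=\mathcal{G}(b,a)$. $\mathcal{F}$-Wythoff is the impartial game with the following legal moves: (i) remove any positive number of tokens from one pile; (ii) remove the same positive number $k$ of tokens from both piles, provided the integer ratio of the two entries does not change, i.e. from $(a,b)$ with $1\le a\le b$ one may move to $(a-k,b-k)$ with $1\le k<a$ if $\lfloor (b-k)/(a-k)\rfloor=\lfloor b/a\rfloor$. The followers of $p$ are the positions reachable from $p$ by one legal move. For a finite set $S$ of nonnegative integers, $\mathrm{mex}(S)$ is the smallest nonnegative integer not in $S$ (so $\mathrm{mex}\,\emptyset=0$). The Sprague-Grundy value is defined inductively by $\mathcal{G}(p)=\mathrm{mex}\{\mathcal{G}(q)\mid q \text{ is a follower of } p\}$. *)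

(* Defs.v *)
From mathcomp Require Import all_boot.

Set Implicit Arguments.
Unset Strict Implicit.
Unset Printing Implicit Defensive.

(* An unordered pair is represented by its sorted representative. *)
Definition position : Type := {p : nat * nat | p.1 <= p.2}.

Lemma minn_leq_maxn a b : minn a b <= maxn a b.
Proof. by rewrite geq_min !leq_max leqnn. Qed.

Definition pos (a b : nat) : position :=
  exist (fun p : nat * nat => p.1 <= p.2) (minn a b, maxn a b)
        (minn_leq_maxn a b).

Lemma posC a b : pos a b = pos b a.
Proof. by apply: val_inj; rewrite /= minnC maxnC. Qed.

Lemma pos_eq a b c d :
  pos a b = pos c d <-> (a = c /\ b = d) \/ (a = d /\ b = c).
Proof.
split=> [/(congr1 val) /= [] | [[-> ->] // | [-> ->]]]; last exact: posC.
by case: (leqP a b) => _; case: (leqP c d) => _ -> ->; [left|right|right|left].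
Qed.

Definition smaller (p : position) : nat := (val p).1.
Definition larger (p : position) : nat := (val p).2.

(* [iota 1 n] is the range 1 <= k <= n, hence [iota 1 a.-1] is 1 <= k < a
   (and it is empty for a = 0). *)
Definition followers (p : position) : seq position :=
  let a := smaller p in
  let b := larger p in
     [seq pos (a - k) b | k <- iota 1 a]
  ++ [seq pos a (b - k) | k <- iota 1 b]
  ++ [seq pos (a - k) (b - k) | k <- iota 1 a.-1 &
        (b - k) %/ (a - k) == b %/ a].

Lemma mex_subproof (s : seq nat) : exists n, n \notin s.
Proof.
exists (sumn s).+1; apply/negP=> ins.
have: (sumn s).+1 <= sumn s.
  by rewrite [X in _ <= X](perm_sumn (perm_to_rem ins)) leq_addr.
by rewrite ltnn.
Qed.

Definition mex (s : seq nat) : nat := ex_minn (mex_subproof s).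

Definition tokens (p : position) : nat := smaller p + larger p.

(* Recursion on a bound for the number of moves still to be played; every move
   removes a token, so [tokens p] is large enough, and [grundyE] is the
   inductive definition of the Sprague-Grundy value. *)
Fixpoint grundy_rec (n : nat) (p : position) : nat :=
  if n is n'.+1 then mex [seq grundy_rec n' q | q <- followers p] else 0.

Definition grundy (p : position) : nat := grundy_rec (tokens p).+1 p.

Lemma tokens_pos a b : tokens (pos a b) = a + b.
Proof. by rewrite /tokens /smaller /larger /= addn_min_max. Qed.

Lemma tokens_followers p q : q \in followers p -> tokens q < tokens p.
Proof.
rewrite /followers [tokens p]/tokens.
set a := smaller p; set b := larger p.
have ab : a <= b by exact: (valP p).
rewrite !mem_cat => /or3P [] /mapP [k].
- rewrite mem_iota => /andP [k0]; rewrite add1n ltnS => ka ->.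
  by rewrite tokens_pos ltn_add2r ltn_subrL k0 (leq_trans k0 ka).
- rewrite mem_iota => /andP [k0]; rewrite add1n ltnS => kb ->.
  by rewrite tokens_pos ltn_add2l ltn_subrL k0 (leq_trans k0 kb).
rewrite mem_filter mem_iota => /andP [_ /andP [k0 ka]] ->.
have a0 : 0 < a by case: (a) ka k0 => //=; case: k.
by rewrite tokens_pos -addSn leq_add ?leq_subr // ltn_subrL k0.
Qed.

Lemma grundy_recE n m p : tokens p < n -> tokens p < m ->
  grundy_rec n p = grundy_rec m p.
Proof.
elim: n m p => [|n IHn] [|m] p //=; rewrite !ltnS => pn pm.
congr mex; apply/eq_in_map => q /tokens_followers qp.
by apply: IHn; [exact: leq_trans qp pn | exact: leq_trans qp pm].
Qed.

Lemma grundyE p : grundy p = mex [seq grundy q | q <- followers p].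
Proof.
rewrite {1}/grundy /=; congr mex; apply/eq_in_map => q /tokens_followers qp.
exact: grundy_recE.
Qed.

(* Main.v *)
Require Import Defs.
From mathcomp Require Import all_boot.

(** A value occurs at most once in a row because two entries of a row are joined
by a move.  For existence, argue by induction on the row [a] and the value [g]:
far enough out, an entry of row [a] is past every occurrence of a smaller value
in row [a], so its value is [g] or else some follower has value [g]; and its
followers in earlier rows are past the occurrences of [g] there, so this
follower lies in row [a]. *)

Lemma mexP s : mex s \notin s /\ forall n, n < mex s -> n \in s.
Proof.
rewrite /mex; case: ex_minnP => m ms m_min; split=> // n.
by rewrite ltnNge; apply: contraR; apply: m_min.
Qed.

Lemma grundy_follower p q : q \in followers p -> grundy q <> grundy p.
Proof.
move=> qp; rewrite (grundyE p) => gq.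
have [/negP + _] := mexP [seq grundy q | q <- followers p]; apply.
by rewrite -gq map_f.
Qed.

Lemma row_follower a b c : b < c -> pos a b \in followers (pos a c).
Proof.
move=> bc; rewrite /followers /smaller /larger /= !mem_cat.
(* [pos] sorts its entries, so shrinking the pile [c] is a move on the larger or on the smaller
   entry, depending on how [a] and [c] compare. *)
case: (leqP a c) => [ac|ca]; apply/or3P.
  apply: Or32; apply/mapP; exists (c - b); last by rewrite subKn // ltnW.
  by rewrite mem_iota subn_gt0 bc add1n ltnS leq_subr.
apply: Or31; apply/mapP; exists (c - b); last by rewrite subKn 1?ltnW // posC.
by rewrite mem_iota subn_gt0 bc add1n ltnS leq_subr.
Qed.

Lemma grundy_row_inj a : injective (fun b => grundy (pos a b)).
Proof.
move=> b c /= gbc; case: (ltngtP b c) => // lt_bc.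
  by have := grundy_follower _ _ (row_follower a _ _ lt_bc) gbc.
by have := grundy_follower _ _ (row_follower a _ _ lt_bc) (esym gbc).
Qed.

(** A move that shrinks the pile [a] takes at most [a] tokens from the other pile, so for large [b]
    it ends far out in an earlier row. *)
Lemma follower_cases a b q : a <= b -> q \in followers (pos a b) ->
  (exists c, q = pos a c) \/
  (exists a' c, [/\ a' < a, b <= c + a & q = pos a' c]).
Proof.
move=> ab; rewrite /followers /smaller /larger /=.
rewrite (minn_idPl ab) (maxn_idPr ab) !mem_cat => /or3P [] /mapP [k].
- rewrite mem_iota add1n ltnS => /andP [k0 ka] ->; right.
  by exists (a - k), b; rewrite ltn_subrL k0 (leq_trans k0 ka) leq_addr.
- by move=> _ ->; left; exists (b - k).
rewrite mem_filter mem_iota => /and3P [_ k0 ka] ->; right.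
(* For [a = 0] the range only says [k < 1], which [k0] excludes. *)
have {}ka : k <= a.
  by case: (a) ka => [|a'] /=; [case: (k) k0 | rewrite add1n => /ltnW].
exists (a - k), (b - k); split=> //.
  by rewrite ltn_subrL k0 (leq_trans k0 ka).
by rewrite addnC -leq_subLR leq_sub2l.
Qed.

Lemma uniform_bound (P : nat -> nat -> Prop) n :
  (forall i, i < n -> exists m, forall b, P i b -> b < m) ->
  exists m, forall i b, i < n -> P i b -> b < m.
Proof.
elim: n => [|n IHn] bnd; first by exists 0.
have [m1 m1P] := IHn (fun i lt_in => bnd i (ltnW lt_in)).
have [m2 m2P] := bnd n (ltnSn n).
exists (maxn m1 m2) => i b; rewrite ltnS leq_eqVlt leq_max.
case/predU1P=> [-> /m2P -> | lt_in /(m1P _ _ lt_in) -> //].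
by rewrite orbT.
Qed.

Lemma grundy_row_bound a g : (exists b, grundy (pos a b) = g) ->
  exists m, forall b, grundy (pos a b) = g -> b < m.
Proof.
by case=> c gc; exists c.+1 => b; rewrite -gc => /grundy_row_inj ->.
Qed.

Lemma grundy_row_surj a g : exists b, grundy (pos a b) = g.
Proof.
elim/ltn_ind: a g => a IHa g; elim/ltn_ind: g => g IHg.
(* [m1] bounds the occurrences of [g] in the rows before [a], [m2] those of the values below [g] in
   row [a]. *)
have [m1 m1P] := uniform_bound _ _
  (fun i lt_ia => grundy_row_bound _ _ (IHa i lt_ia g)).
have [m2 m2P] := uniform_bound _ _
  (fun i lt_ig => grundy_row_bound _ _ (IHg i lt_ig)).
(* The summand [a] absorbs the loss in a diagonal move: [b <= c + a] still gives [m1 <= c]. It also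
   ensures [a <= b]. *)
pose b := maxn m1 m2 + a.
case: (ltngtP (grundy (pos a b)) g) => [lt_g|gt_g|]; last by exists b.
  have := m2P _ _ lt_g erefl.
  by rewrite ltnNge (leq_trans (leq_maxr m1 m2)) ?leq_addr.
(* Here the value at [b] exceeds [g], so by the mex rule [g] is the value of a follower. *)
have: g \in [seq grundy q | q <- followers (pos a b)].
  by apply: (mexP _).2; rewrite -grundyE.
case/mapP=> q /(follower_cases _ _ _ (leq_addl _ _)).
case=> [[c ->] ->|[a' [c [lt_a' le_bc ->]] gc]]; first by exists c.
have := m1P _ _ lt_a' (esym gc).
by rewrite ltnNge (leq_trans (leq_maxl m1 m2)) // -(leq_add2r a).
Qed.

Theorem theorem10 (a g : nat) : exists! b : nat, grundy (pos a b) = g.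
Proof.
have [b gb] := grundy_row_surj a g.
by exists b; split=> // c; rewrite -gb => /grundy_row_inj.
Qed.
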